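(* Let $d\ge 1$ be an integer and let $G=(V,E)$ be an undirected graph with $|V|=n$ and $|E|=m$. (ILP) There exists an ILP formulation with $O(n^d(n+m))$ variables and $O(n^{d+2})$ constraints that has a (feasible) solution if and only if $G$ has boxicity $d$. (SAT) There exists a SAT formulation with $O(n^d(n+m))$ variables and $O(n^{d+2})$ clauses, each of size $O(n^d)$, that has a solution if and only if $G$ has boxicity $d$.
   Context: Graphs are finite and simple with $n\ge 1$. A graph $G$ is said to have boxicity $d$ if it can be represented as the intersection graph of $d$-dimensional axis-aligned boxes, i.e., if one can assign to each vertex a non-empty axis-aligned box in $\mathbb R^d$ such that two distinct vertices are adjacent if and only if their boxes intersect. (In this convention, ''boxicity $d$'' means representable in dimension $d$, not that $d$ is minimal.) An ILP formulation is a rule that constructs from the input (here $G$, with $d$ fixed) an integer linear program; a SAT formulation is a rule that constructs from the input a Boolean formula in conjunctive normal form, whose solutions are its satisfying assignments. In both cases the rule is required to be computable in time polynomial in the size of the input plus the size of the constructed instance. The size of a clause is its number of literals. The dimension $d$ is fixed, so the constants in the $O$-bounds may depend on $d$. *)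

(* Defs.v *)
From HB Require Import structures.
From mathcomp Require Import all_boot all_order all_algebra.
From mathcomp Require Import classical_sets reals.

Set Implicit Arguments.
Unset Strict Implicit.
Unset Printing Implicit Defensive.

Import Order.TTheory GRing.Theory Num.Theory.

(** * Graphs and boxicity *)

(* Since graphs are inputs of algorithms, the vertex set is {0, ..., n-1}. *)
Record sgraph := SGraph {
  nb_vertices : nat;
  nb_vertices_gt0 : 0 < nb_vertices;
  adj : rel 'I_nb_vertices;
  adj_sym : symmetric adj;
  adj_irr : irreflexive adj }.

Definition edges (G : sgraph) : {set {set 'I_(nb_vertices G)}} :=
  [set A | [exists u, exists v, adj u v && (A == [set u; v])]].

Definition nb_edges (G : sgraph) : nat := #|edges G|.

Section Boxicity.
Local Open Scope ring_scope.
Local Open Scope classical_set_scope.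

Definition box (R : realType) (d : nat) (l h : 'rV[R]_d) : set 'rV[R]_d :=
  [set x | forall i, l ord0 i <= x ord0 i <= h ord0 i].

Definition is_box (R : realType) (d : nat) (B : set 'rV[R]_d) : Prop :=
  exists l h, B = box l h.

(* "Representable in dimension d"; d need not be minimal. *)
Definition has_boxicity (R : realType) (d : nat) (G : sgraph) : Prop :=
  exists B : 'I_(nb_vertices G) -> set 'rV[R]_d,
    (forall v, is_box (B v) /\ B v !=set0) /\
    (forall u v, u != v -> (adj u v <-> B u `&` B v !=set0)).

End Boxicity.

(** * Integer linear programs and CNF formulas *)

(* maximize ilp_obj *m x subject to ilp_mat *m x <= ilp_rhs, x integral *)
Record ilp := ILP {
  ilp_nvars : nat;
  ilp_ncons : nat;
  ilp_obj : 'rV[int]_ilp_nvars;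
  ilp_mat : 'M[int]_(ilp_ncons, ilp_nvars);
  ilp_rhs : 'cV[int]_ilp_ncons }.

Definition ilp_feasible (P : ilp) : Prop :=
  exists x : 'cV[int]_(ilp_nvars P),
    forall i, ((ilp_mat P *m x) i ord0 <= ilp_rhs P i ord0)%R.

(* The literal (true, i) is the variable i, and (false, i) its negation. *)
Definition literal (N : nat) : Type := (bool * 'I_N)%type.

Record cnf := CNF {
  cnf_nvars : nat;
  cnf_clauses : seq (seq (literal cnf_nvars)) }.

Definition cnf_satisfiable (F : cnf) : Prop :=
  exists a : 'I_(cnf_nvars F) -> bool,
    all (fun c => has (fun l => a l.2 == l.1) c) (cnf_clauses F).

(** * Polynomial time *)

(* The model of computation is Jones's language WHILE: imperative programs over
   binary trees, with a unit charge for each elementary operation. A function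
   is computable in time polynomial in the sizes of its input and output by a
   WHILE program iff it is by a Turing machine (N. D. Jones, Computability and
   Complexity from a Programming Perspective, MIT Press, 1997). Trees have no
   arithmetic, and numbers are encoded by their binary digits. *)

Inductive tree := Nil | Cons of tree & tree.

Fixpoint tsize (t : tree) : nat :=
  if t is Cons a b then (tsize a + tsize b).+1 else 1.

Inductive expr :=
  | EVar of nat
  | ENil
  | ECons of expr & expr
  | EHd of expr
  | ETl of expr.

Inductive cmd :=
  | Skip
  | Assign of nat & expr
  | Seq of cmd & cmd
  | If of expr & cmd & cmd
  | While of expr & cmd.

Definition store := nat -> tree.

Definition update (s : store) (i : nat) (v : tree) : store :=
  fun j => if j == i then v else s j.

Fixpoint eval (e : expr) (s : store) : tree :=
  match e with
  | EVar i => s i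
  | ENil => Nil
  | ECons e1 e2 => Cons (eval e1 s) (eval e2 s)
  | EHd e1 => if eval e1 s is Cons a _ then a else Nil
  | ETl e1 => if eval e1 s is Cons _ b then b else Nil
  end.

Fixpoint ecost (e : expr) : nat :=
  match e with
  | EVar _ | ENil => 1
  | ECons e1 e2 => (ecost e1 + ecost e2).+1
  | EHd e1 | ETl e1 => (ecost e1).+1
  end.

(* exec c s t s' : run from the store s, the command c halts after t elementary
   operations in the store s'. As a condition, Nil is false and every other
   tree is true. *)
Inductive exec : cmd -> store -> nat -> store -> Prop :=
  | ExSkip s : exec Skip s 1 s
  | ExAssign s i e :
      exec (Assign i e) s (ecost e).+1 (update s i (eval e s))
  | ExSeq c1 c2 s1 s2 s3 t1 t2 :
      exec c1 s1 t1 s2 -> exec c2 s2 t2 s3 ->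
      exec (Seq c1 c2) s1 (t1 + t2) s3
  | ExIfT e c1 c2 s s' t :
      eval e s <> Nil -> exec c1 s t s' ->
      exec (If e c1 c2) s (ecost e + t).+1 s'
  | ExIfF e c1 c2 s s' t :
      eval e s = Nil -> exec c2 s t s' ->
      exec (If e c1 c2) s (ecost e + t).+1 s'
  | ExWhileF e c s :
      eval e s = Nil -> exec (While e c) s (ecost e).+1 s
  | ExWhileT e c s1 s2 s3 t1 t2 :
      eval e s1 <> Nil -> exec c s1 t1 s2 -> exec (While e c) s2 t2 s3 ->
      exec (While e c) s1 (ecost e + t1 + t2).+1 s3.

(* The input is read from, and the output left in, the variable 0. *)
Definition init_store (v : tree) : store := update (fun=> Nil) 0 v.

(* Tree sizes are positive, so the bounds k * N ^ k dominate all polynomials. *)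
Definition polytime (X Y : Type) (encX : X -> tree) (encY : Y -> tree)
    (f : X -> Y) : Prop :=
  exists (c : cmd) (k : nat), forall x : X, exists (t : nat) (s : store),
    [/\ exec c (init_store (encX x)) t s,
        s 0 = encY (f x) &
        t <= k * (tsize (encX x) + tsize (encY (f x))) ^ k].

(** * Encodings *)

Definition enc_bool (b : bool) : tree := if b then Cons Nil Nil else Nil.

Definition enc_seq (T : Type) (enc : T -> tree) (s : seq T) : tree :=
  foldr (fun x t => Cons (enc x) t) Nil s.

(* binary digits, least significant first; the empty list for 0 *)
Fixpoint pos_bits (p : BinNums.positive) : seq bool :=
  match p with
  | BinNums.xH => [:: true]
  | BinNums.xO q => false :: pos_bits q
  | BinNums.xI q => true :: pos_bits q
  end.

Definition enc_nat (n : nat) : tree :=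
  enc_seq enc_bool (if bin_of_nat n is BinNums.Npos p then pos_bits p else [::]).

Definition enc_int (z : int) : tree :=
  Cons (enc_bool (z < 0)%R) (enc_nat `|z|%N).

(* the adjacency matrix *)
Definition enc_graph (G : sgraph) : tree :=
  enc_seq (fun u => enc_seq (fun v => enc_bool (adj u v)) (enum 'I_(nb_vertices G)))
    (enum 'I_(nb_vertices G)).

(* the objective row, followed by one pair (row, right-hand side) for each
   constraint *)
Definition enc_ilp (P : ilp) : tree :=
  Cons (enc_seq (fun j => enc_int (ilp_obj P ord0 j)) (enum 'I_(ilp_nvars P)))
    (enc_seq (fun i =>
       Cons (enc_seq (fun j => enc_int (ilp_mat P i j)) (enum 'I_(ilp_nvars P)))
         (enc_int (ilp_rhs P i ord0)))
      (enum 'I_(ilp_ncons P))).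

Definition enc_cnf (F : cnf) : tree :=
  Cons (enc_nat (cnf_nvars F))
    (enc_seq (enc_seq (fun l : literal (cnf_nvars F) =>
       Cons (enc_bool l.1) (enc_nat l.2))) (cnf_clauses F)).

Definition ilp_formulation (f : sgraph -> ilp) : Prop :=
  polytime enc_graph enc_ilp f.

Definition sat_formulation (f : sgraph -> cnf) : Prop :=
  polytime enc_graph enc_cnf f.

(* Main.v *)
(* A graph has boxicity [d] iff it is the intersection of [d] interval graphs.
   A relation [P] ("entirely to the left of") comes from intervals iff it is
   irreflexive and there is a total relation [A] ("has a left end at most that
   of") such that [P u v] and [A v w] imply [P u w]: the sets
   [{u | P u v}] are then nested, and their cardinals can be taken as left ends.
   This gives a CNF formula with [O(d n^2)] variables and [O(d n^3)] clauses,
   within the bounds for every [d >= 1]. Each clause is also turned into one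
   linear inequality, where the positive integers stand for true.

   Polynomial time is obtained compositionally: the functions on trees computed
   by a WHILE program in polynomial time, with outputs of polynomial size, are
   closed under composition, pairing, tests, and recursion on a list whose
   accumulator grows by a bounded amount at each step. *)
Require Import Defs.
From mathcomp Require Import all_boot all_order all_algebra.
From mathcomp Require Import classical_sets reals.
From mathcomp Require Import zify.

Set Implicit Arguments.
Unset Strict Implicit.
Unset Printing Implicit Defensive.

(* MathComp shadows [tsize], [Nil] and [Cons]. *)
Import Defs.

(** * Polynomial bounds in the size of a tree *)

Lemma tsize_gt0 t : 0 < tsize t.
Proof. by case: t. Qed.

Lemma leq_expr m n e : m <= n -> m ^ e <= n ^ e.
Proof. by case: e => // e le_mn; rewrite leq_exp2r. Qed.

Definition pbound (f : tree -> nat) :=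
  exists k, forall z, f z <= k * tsize z ^ k.

Lemma pbound_monomial (f : tree -> nat) a b :
  (forall z, f z <= a * tsize z ^ b) -> pbound f.
Proof.
move=> le_f; exists (a + b) => z; apply: leq_trans (le_f z) _.
by rewrite leq_mul ?leq_addr // leq_pexp2l ?tsize_gt0 ?leq_addl.
Qed.

Lemma pbound_le g f : pbound g -> (forall z, f z <= g z) -> pbound f.
Proof. by case=> k le_g le_fg; exists k => z; apply: leq_trans (le_fg z) _. Qed.

Lemma pbound_cst c : pbound (fun=> c).
Proof. by apply: (@pbound_monomial _ c 0) => z; rewrite muln1. Qed.

Lemma pbound_tsize : pbound tsize.
Proof. by exists 1 => z; rewrite mul1n. Qed.

Lemma pbound_add f g : pbound f -> pbound g -> pbound (fun z => f z + g z).
Proof.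
move=> [k le_f] [l le_g]; apply: (@pbound_monomial _ (k + l) (k + l)) => z.
rewrite mulnDl leq_add //.
- by apply: leq_trans (le_f z) _; rewrite leq_mul // leq_pexp2l ?tsize_gt0 ?leq_addr.
- by apply: leq_trans (le_g z) _; rewrite leq_mul // leq_pexp2l ?tsize_gt0 ?leq_addl.
Qed.

Lemma pbound_mul f g : pbound f -> pbound g -> pbound (fun z => f z * g z).
Proof.
move=> [k le_f] [l le_g]; apply: (@pbound_monomial _ (k * l) (k + l)) => z.
by rewrite expnD mulnACA leq_mul.
Qed.

Lemma pbound_exp f m : pbound f -> pbound (fun z => f z ^ m).
Proof.
move=> [k le_f]; apply: (@pbound_monomial _ (k ^ m) (k * m)) => z.
by rewrite expnM -expnMn leq_expr // le_f.
Qed.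

(** Only the size of [g z] enters the bound on [f (g z)]. This is why output sizes are tracked along
    with running times. *)
Lemma pbound_comp f g :
  pbound f -> pbound (tsize \o g) -> pbound (f \o g).
Proof.
move=> [k le_f] pg; apply: (@pbound_le (fun z => k * tsize (g z) ^ k)).
  by apply: pbound_mul; [apply: pbound_cst | apply: pbound_exp].
by move=> z; apply: le_f.
Qed.

(** * Rules of total correctness with time budgets *)

Definition run c s T (Q : store -> Prop) :=
  exists t s', [/\ exec c s t s', t <= T & Q s'].

Lemma run_skip s T (Q : store -> Prop) : Q s -> 0 < T -> run Skip s T Q.
Proof. by move=> Qs T0; exists 1, s; split=> //; constructor. Qed.

Lemma run_assign s i e T (Q : store -> Prop) :
  Q (update s i (eval e s)) -> ecost e < T -> run (Assign i e) s T Q.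
Proof. by move=> Qs le_T; exists (ecost e).+1, (update s i (eval e s)); split=> //; constructor. Qed.

Lemma run_seq c1 c2 s T1 T2 T Q1 (Q : store -> Prop) :
    run c1 s T1 Q1 -> (forall s1, Q1 s1 -> run c2 s1 T2 Q) -> T1 + T2 <= T ->
  run (Seq c1 c2) s T Q.
Proof.
move=> [t1 [s1 [ex1 le1 Q1s]]] run2 leT; have [t2 [s2 [ex2 le2 Qs]]] := run2 _ Q1s.
exists (t1 + t2), s2; split=> //; first exact: ExSeq ex1 ex2.
by apply: leq_trans leT; apply: leq_add.
Qed.

Lemma run_if e c1 c2 s T (Q : store -> Prop) :
    (if eval e s is Cons _ _ then run c1 s T Q else run c2 s T Q) ->
  run (If e c1 c2) s (ecost e + T).+1 Q.
Proof.
case def_e: (eval e s) => [|x y] [t [s' [ex_c leT Qs']]]; exists (ecost e + t).+1, s'.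
  by split=> //; [apply: ExIfF | rewrite ltnS leq_add2l].
by split=> //; [apply: ExIfT; rewrite ?def_e | rewrite ltnS leq_add2l].
Qed.

(** One unfolding of the loop: the body has to establish that the rest of the loop meets its own
    budget. The induction over the iterations is left to the user of the rule. *)
Lemma run_while e c s T (Q : store -> Prop) :
    (if eval e s is Cons _ _ then
       exists T1 T2, (ecost e + T1 + T2).+1 <= T /\
         run c s T1 (fun s1 => run (While e c) s1 T2 Q)
     else ecost e < T /\ Q s) ->
  run (While e c) s T Q.
Proof.
case def_e: (eval e s) => [|x y].
  by case=> leT Qs; exists (ecost e).+1, s; split=> //; apply: ExWhileF.
case=> T1 [T2 [leT [t1 [s1 [ex1 le1 [t2 [s2 [ex2 le2 Qs2]]]]]]]].
exists (ecost e + t1 + t2).+1, s2; split=> //.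
  by apply: ExWhileT ex1 ex2; rewrite def_e.
by apply: leq_trans leT; rewrite ltnS leq_add ?leq_add2l.
Qed.

(* The command [c b] works on the variable [b], both as input and output: it
   may overwrite the variables above [b] but not the ones below. *)
Definition computes (F : tree -> tree) (c : nat -> cmd) (T : tree -> nat) :=
  forall b s, run (c b) s (T (s b))
    (fun s' => s' b = F (s b) /\ forall j, j < b -> s' j = s j).

(** The bound on the output is a separate requirement: with unit charges, repeated assignments of
    [Cons x x] to [x] give a tree of exponential size in linear time. *)
Definition ptime (F : tree -> tree) :=
  exists (c : nat -> cmd) (T : tree -> nat),
    [/\ pbound T, pbound (tsize \o F) & computes F c T].

Lemma ptime_polytime X Y (encX : X -> tree) (encY : Y -> tree) (f : X -> Y) F :
  ptime F -> (forall x, F (encX x) = encY (f x)) -> polytime encX encY f.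
Proof.
move=> [c [T [[k leT] _ runF]]] Ff; exists (c 0), k => x.
have [t [s [ex_c le_t [s0 _]]]] := runF 0 (init_store (encX x)).
exists t, s; split=> //; first by rewrite s0 -Ff.
apply: leq_trans le_t (leq_trans (leT _) _).
by rewrite leq_mul // leq_expr // leq_addr.
Qed.

(** * Closure properties of polynomial time *)

Lemma eq_ptime F F' : F =1 F' -> ptime F -> ptime F'.
Proof.
move=> eqF [c [T [pT pF runF]]]; exists c, T; split=> //.
  by apply: pbound_le pF _ => z /=; rewrite eqF.
by move=> b s; rewrite -eqF.
Qed.

Lemma ptime_id : ptime id.
Proof.
exists (fun=> Skip), (fun=> 1); split; [exact: pbound_cst | exact: pbound_tsize |].
by move=> b s; apply: run_skip.
Qed.

Lemma ptime_comp F G : ptime F -> ptime G -> ptime (F \o G).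
Proof.
move=> [c [T [pT pF runF]]] [c' [T' [pT' pG runG]]].
exists (fun b => Seq (c' b) (c b)), (fun z => T' z + T (G z)); split.
- by apply: pbound_add pT' _; apply: pbound_comp pT pG.
- exact: pbound_comp pF pG.
- move=> b s; apply: run_seq (runG b s) _ (leqnn _) => s1 [s1b s1j] /=.
  have [t [s2 [ex_c le_t [s2b s2j]]]] := runF b s1.
  rewrite s1b in le_t s2b; exists t, s2; split=> //; split=> // j lt_jb.
  by rewrite s2j ?s1j.
Qed.

Lemma update_eq s i v : update s i v i = v.
Proof. by rewrite /update eqxx. Qed.

Lemma update_neq s i v j : j != i -> update s i v j = s j.
Proof. by rewrite /update => /negPf->. Qed.

Lemma ptime_expr (e : nat -> expr) F k :
    (forall b s, eval (e b) s = F (s b)) -> (forall b, ecost (e b) = k) ->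
  pbound (tsize \o F) -> ptime F.
Proof.
move=> eF cost pF; exists (fun b => Assign b (e b)), (fun=> k.+1).
split=> //; [exact: pbound_cst | move=> b s; apply: run_assign; last by rewrite cost].
rewrite update_eq eF; split=> // j lt_jb; rewrite update_neq //; lia.
Qed.

(** The tree is written out as one expression, whose cost does not depend on the input. *)
Lemma ptime_cst t : ptime (fun=> t).
Proof.
pose e := fix e t := if t is Cons a b then ECons (e a) (e b) else ENil.
apply: (@ptime_expr (fun=> e t) _ (ecost (e t))) => //; last exact: pbound_cst.
by move=> b s; elim: t => //= t1 -> t2 ->.
Qed.

Definition thd t := if t is Cons a _ then a else Nil.
Definition ttl t := if t is Cons _ b then b else Nil.

Lemma ptime_hd F : ptime F -> ptime (fun z => thd (F z)).
Proof.
apply: (@ptime_comp thd); apply: (@ptime_expr (EHd \o EVar) _ 2) => //.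
by apply: pbound_le pbound_tsize _ => -[|a b] //=; lia.
Qed.

Lemma ptime_tl F : ptime F -> ptime (fun z => ttl (F z)).
Proof.
apply: (@ptime_comp ttl); apply: (@ptime_expr (ETl \o EVar) _ 2) => //.
by apply: pbound_le pbound_tsize _ => -[|a b] //=; lia.
Qed.

Lemma run_weaken c s T T' (Q Q' : store -> Prop) :
  run c s T Q -> T <= T' -> (forall s', Q s' -> Q' s') -> run c s T' Q'.
Proof.
move=> [t [s' [ex_c le_t Qs]]] leT QQ'; exists t, s'; split=> //; last exact: QQ'.
exact: leq_trans leT.
Qed.

(** Working on a copy of the input in a higher variable keeps the original, so that several
    computations can read the same input one after the other. *)
Lemma run_load F c T b b' s : computes F c T -> b < b' ->
  run (Seq (Assign b' (EVar b)) (c b')) s (T (s b)).+2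
    (fun s' => s' b' = F (s b) /\ forall j, j < b' -> s' j = s j).
Proof.
move=> runF lt_bb'; apply: (@run_seq _ _ _ 2 (T (s b)) _ (fun s1 => s1 = update s b' (s b))).
- exact: run_assign.
- move=> s1 ->; apply: run_weaken (runF b' _) _ _; rewrite update_eq //.
  move=> s' [-> s'j]; split=> // j lt_j; rewrite s'j // update_neq //; lia.
- by rewrite add2n.
Qed.

Lemma ptime_cons F G : ptime F -> ptime G -> ptime (fun z => Cons (F z) (G z)).
Proof.
move=> [c [T [pT pF runF]]] [c' [T' [pT' pG runG]]].
exists (fun b => Seq (Seq (Assign b.+1 (EVar b)) (c b.+1))
   (Seq (Seq (Assign b.+2 (EVar b)) (c' b.+2))
        (Assign b (ECons (EVar b.+1) (EVar b.+2))))),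
   (* Each copy costs 2, and the final assignment 4. *)
   (fun z => (T z).+2 + ((T' z).+2 + 4)); split.
- apply: pbound_le (pbound_add (pbound_add pT pT') (pbound_cst 8)) _ => z; lia.
- apply: pbound_le (pbound_add (pbound_add pF pG) (pbound_cst 1)) _ => z /=; lia.
- move=> b s; apply: run_seq (run_load (b' := b.+1) s runF _) _ (leqnn _) => //.
  move=> s1 [s1b s1j].
  apply: run_seq (run_load (b := b) (b' := b.+2) s1 runG _) _ _ => //; last first.
    by rewrite s1j.
  move=> s2 [s2b s2j]; apply: run_assign => //=.
  rewrite update_eq s2b !s2j // s1b s1j //; split=> // j lt_jb.
  by rewrite update_neq ?s2j ?s1j //; lia.
Qed.

Definition is_cons t := if t is Cons _ _ then true else false.

Lemma ptime_if p F G : ptime (fun z => enc_bool (p z)) -> ptime F -> ptime G ->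
  ptime (fun z => if p z then F z else G z).
Proof.
move=> [cp [Tp [pTp _ runp]]] [c [T [pT pF runF]]] [c' [T' [pT' pG runG]]].
exists (fun b => Seq (Seq (Assign b.+1 (EVar b)) (cp b.+1))
                  (If (EVar b.+1) (c b) (c' b))),
  (fun z => (Tp z).+2 + (1 + (T z + T' z)).+1); split.
- apply: pbound_le (pbound_add pTp (pbound_add (pbound_add pT pT') (pbound_cst 4))) _ => z; lia.
- by apply: pbound_le (pbound_add pF pG) _ => z /=; case: (p z); lia.
- move=> b s; apply: run_seq (run_load (b' := b.+1) s runp _) _ (leqnn _) => //.
  move=> s1 [s1b s1j]; apply: run_if => /=; rewrite s1b.
  case: (p (s b)) => /=.
    apply: run_weaken (runF b s1) _ _; first by rewrite s1j ?leq_addr.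
    by move=> s2 []; rewrite s1j // => -> s2j; split=> // j lt_jb; rewrite s2j ?s1j //; lia.
  apply: run_weaken (runG b s1) _ _; first by rewrite s1j ?leq_addl.
  by move=> s2 []; rewrite s1j // => -> s2j; split=> // j lt_jb; rewrite s2j ?s1j //; lia.
Qed.

(** * Bounded recursion on lists *)

Fixpoint tfold (g : tree -> tree -> tree) (i l : tree) :=
  if l is Cons a l' then g a (tfold g i l') else i.

Fixpoint tfoldl (g : tree -> tree -> tree) (l i : tree) :=
  if l is Cons a l' then tfoldl g l' (g a i) else i.

(** A loop performs a left fold; for [m = Nil], this reduces a right fold to a left fold over the
    reversed list. *)
Lemma tfoldl_rev g l m i : tfoldl g (tfoldl Cons l m) i = tfoldl g m (tfold g i l).
Proof. by elim: l m => //= a _ l IHl m; rewrite IHl. Qed.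

Lemma tsize_rev l m : tsize (tfoldl Cons l m) + 1 = tsize l + tsize m.
Proof. by elim: l m => [|a _ l IHl] m /=; rewrite ?IHl /=; lia. Qed.

(** The variables from [b] on hold the context, the accumulator, the rest of the list, and the
    working copy of their triple. The invariant is that the accumulator, increased by [D] per unit
    of size of the remaining list, stays within [E]; a step then costs at most [K], and 15 covers
    the bookkeeping. *)
Lemma run_foldl (G : tree -> tree -> tree -> tree) (c : nat -> cmd) (T : tree -> nat) b z D E K l acc s :
    computes (fun w => G (thd w) (thd (ttl w)) (ttl (ttl w))) c T ->
    (forall a x, tsize a <= tsize l -> tsize (G z a x) <= tsize x + D) ->
    (forall a x, tsize a <= tsize l -> tsize x <= E -> T (Cons z (Cons a x)) <= K) ->
    tsize acc + tsize l * D <= E ->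
    s b = z -> s b.+1 = acc -> s b.+2 = l ->
  run (While (EVar b.+2)
         (Seq (Assign b.+3 (ECons (EVar b) (ECons (EHd (EVar b.+2)) (EVar b.+1))))
         (Seq (c b.+3) (Seq (Assign b.+1 (EVar b.+3)) (Assign b.+2 (ETl (EVar b.+2)))))))
    s ((K + 15) * tsize l)
    (fun s' => s' b.+1 = tfoldl (G z) l acc /\ forall j, j <= b -> s' j = s j).
Proof.
move=> runG; elim: l acc s => [|a _ l IHl] acc s leD leK leE sz sacc sl;
  apply: run_while => /=; rewrite sl.
  by split=> //; lia.
(* Budgets of the four commands of the body: forming the triple, the step, storing the accumulator,
   advancing in the list. *)
exists (7 + (K + (2 + 3))), ((K + 15) * tsize l); split; first by rewrite /=; lia.
apply: run_seq (leqnn _).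
  (* The intermediate assertion, left open so far, becomes equality with the updated store. *)
  by apply: run_assign; [exact: erefl | rewrite /=].
move=> _ <-; rewrite /= sl sz sacc.
have le_a : tsize a <= tsize (Cons a l) by rewrite /=; lia.
apply: (@run_seq _ _ _ K (2 + 3) _ (fun s2 => s2 b.+3 = G z a acc /\ forall j, j <= b.+2 -> s2 j = s j)) => //.
  apply: run_weaken (runG _ _) _ _; rewrite update_eq.
    by apply: leK => //; lia.
  move=> s2 [-> s2j]; split=> // j le_j; rewrite s2j // update_neq //; lia.
move=> s2 [s2b s2j]; apply: run_seq (leqnn _).
  by apply: run_assign; [exact: erefl |].
move=> _ <-; apply: run_assign => //=; rewrite update_neq; last lia.
rewrite s2b s2j // sl /=.
set s3 := update _ _ _.
have s3j j : j <= b -> s3 j = s j by move=> le_j; rewrite /s3 !update_neq ?s2j //; lia.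
apply: run_weaken (IHl (G z a acc) s3 _ _ _ _ _ _) (leqnn _) _.
- by move=> a' x le_a'; apply: leD; rewrite /=; lia.
- by move=> a' x le_a' le_x; apply: leK => //=; lia.
- by have := leD a acc le_a; rewrite /= in leE; nia.
- by rewrite s3j.
- by rewrite /s3 update_neq ?update_eq //; lia.
- by rewrite /s3 update_eq.
- by move=> s' [-> s'j]; split=> // j le_j; rewrite s'j ?s3j.
Qed.

Lemma tsize_foldl g i l D :
    (forall a x, tsize a <= tsize l -> tsize (g a x) <= tsize x + D) ->
  tsize (tfoldl g l i) <= tsize i + tsize l * D.
Proof.
elim: l i => [|a _ l IHl] i leD /=; first lia.
have /leD : tsize a <= tsize (Cons a l) by rewrite /=; lia.
move=> /(_ i) le1; apply: leq_trans (IHl _ _) _; last by nia.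
by move=> a' x le_a'; apply: leD; rewrite /=; lia.
Qed.

(* Each step may only add a bounded amount to the size of the accumulator;
   iterated doubling is thus excluded. *)
Lemma ptime_foldl (G : tree -> tree -> tree -> tree) I L D :
    ptime (fun w => G (thd w) (thd (ttl w)) (ttl (ttl w))) -> ptime I -> ptime L ->
    pbound D ->
    (forall z a x, tsize a <= tsize (L z) -> tsize (G z a x) <= tsize x + D z) ->
  ptime (fun z => tfoldl (G z) (L z) (I z)).
Proof.
move=> [cG [TG [[k leTG] _ runG]]] [cI [TI [pTI pI runI]]] [cL [TL [pTL pL runL]]] pD leD.
pose E z := tsize (I z) + tsize (L z) * D z.
have pE : pbound E by apply: pbound_add pI _; apply: pbound_mul.
(* The input of a step is a triple made of the context, an element and an accumulator of size at
   most [E z]; the 2 counts its two [Cons]. *)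
pose K z := k * (tsize z + tsize (L z) + E z + 2) ^ k.
have pK : pbound K.
  apply: pbound_mul (pbound_cst k) (pbound_exp k _).
  apply: pbound_add (pbound_cst 2); apply: pbound_add pE.
  exact: pbound_add pbound_tsize pL.
exists (fun b => Seq (Seq (Assign b.+2 (EVar b)) (cL b.+2))
  (Seq (Seq (Assign b.+3 (EVar b)) (cI b.+3))
  (Seq (Assign b.+1 (EVar b.+3))
  (Seq (While (EVar b.+2)
         (Seq (Assign b.+3 (ECons (EVar b) (ECons (EHd (EVar b.+2)) (EVar b.+1))))
         (Seq (cG b.+3) (Seq (Assign b.+1 (EVar b.+3)) (Assign b.+2 (ETl (EVar b.+2)))))))
       (Assign b (EVar b.+1)))))).
exists (fun z => (TL z).+2 + ((TI z).+2 + (2 + ((K z + 15) * tsize (L z) + 2)))).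
split.
- apply: (@pbound_le (fun z => TL z + (TI z + (K z + 15) * tsize (L z) + 8))); last by move=> z; lia.
  apply: pbound_add pTL (pbound_add (pbound_add pTI (pbound_mul _ pL)) (pbound_cst _)).
  exact: pbound_add pK (pbound_cst _).
- by apply: pbound_le pE _ => z; apply: tsize_foldl; apply: leD.
- move=> b s; apply: run_seq (run_load (b' := b.+2) s runL _) _ (leqnn _) => //.
  move=> s2 [s2b s2j].
  have s2bb : s2 b = s b by rewrite s2j.
  have ltb3 : b < b.+3 by lia.
  apply: run_seq (run_load s2 runI ltb3) _ _; last by rewrite s2bb.
  move=> s3 [s3b s3j]; rewrite s2bb in s3b.
  apply: run_seq (leqnn _); first by apply: run_assign; [exact: erefl |].
  move=> _ <-; rewrite /= s3b.
  set s4 := update _ _ _.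
  have s4b : s4 b = s b by rewrite /s4 update_neq ?s3j //; lia.
  have s4b2 : s4 b.+2 = L (s b) by rewrite /s4 update_neq ?s3j // ?s2b //; lia.
  apply: (@run_seq _ _ _ ((K (s b) + 15) * tsize (L (s b))) 2) (leqnn _).
    apply: (run_foldl (G := G) (E := E (s b)) (z := s b) runG) s4b (update_eq _ _ _) s4b2.
    - exact: leD.
    - move=> a x le_a le_x; apply: leq_trans (leTG _) _.
      rewrite leq_mul // leq_expr //=; lia.
    - exact: leqnn.
  move=> s5 [s5b s5j]; apply: run_assign => //=.
  rewrite update_eq s5b; split=> // j lt_jb.
  rewrite update_neq ?s5j /s4 ?update_neq ?s3j ?s2j //; lia.
Qed.

Lemma ptime_rev L : ptime L -> ptime (fun z => tfoldl Cons (L z) Nil).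
Proof.
move=> pL; have [_ [_ [_ psL _]]] := pL.
apply: (@ptime_foldl (fun _ a x => Cons a x) _ _ (fun z => tsize (L z) + 1)) => //.
- by apply: ptime_cons; [apply: ptime_hd | apply: ptime_tl]; apply: ptime_tl; apply: ptime_id.
- exact: ptime_cst.
- exact: pbound_add psL (pbound_cst 1).
- move=> z a x /=; lia.
Qed.

(** The left fold runs over the reversed list, which has the same size, so the bound on the growth
    carries over. *)
Lemma ptime_fold (G : tree -> tree -> tree -> tree) I L D :
    ptime (fun w => G (thd w) (thd (ttl w)) (ttl (ttl w))) -> ptime I -> ptime L ->
    pbound D ->
    (forall z a x, tsize a <= tsize (L z) -> tsize (G z a x) <= tsize x + D z) ->
  ptime (fun z => tfold (G z) (I z) (L z)).
Proof.
move=> pG pI pL pD leD; apply: eq_ptime (ptime_foldl pG pI (ptime_rev pL) pD _) => [z|z a x].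
  by rewrite tfoldl_rev.
by have /= := tsize_rev (L z) Nil => eq_size le_a; apply: leD; lia.
Qed.

(* The arguments of a step of [ptime_foldl]. *)
Lemma ptime_ctx : ptime (fun w => thd w).
Proof. exact: ptime_hd ptime_id. Qed.

Lemma ptime_elt : ptime (fun w => thd (ttl w)).
Proof. exact: ptime_hd (ptime_tl ptime_id). Qed.

Lemma ptime_acc : ptime (fun w => ttl (ttl w)).
Proof. exact: ptime_tl (ptime_tl ptime_id). Qed.

Lemma pbound_ptime F : ptime F -> pbound (fun z => tsize (F z)).
Proof. by case=> c [T []]. Qed.

Lemma ptime_sub F G : ptime F -> ptime G -> ptime (fun z => F (G z)).
Proof. exact: ptime_comp. Qed.

Definition tapp t u := tfold Cons u t.

Lemma ptime_app F G : ptime F -> ptime G -> ptime (fun z => tapp (F z) (G z)).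
Proof.
move=> pF pG; apply: (ptime_fold (G := fun _ => Cons) (D := fun z => tsize (F z) + 1)) => //.
- exact: ptime_cons ptime_elt ptime_acc.
- exact: pbound_add (pbound_ptime pF) (pbound_cst 1).
- by move=> z a x /=; lia.
Qed.

Lemma tapp_enc T (enc : T -> tree) s1 s2 :
  tapp (enc_seq enc s1) (enc_seq enc s2) = enc_seq enc (s1 ++ s2).
Proof. by elim: s1 => //= x s1 <-. Qed.

Lemma tsize_tapp t u : tsize (tapp t u) + 1 = tsize t + tsize u.
Proof. by rewrite /tapp; elim: t => [|a _ t IHt] /=; lia. Qed.

Lemma ptime_cat T (enc : T -> tree) (s1 s2 : tree -> seq T) :
    ptime (fun z => enc_seq enc (s1 z)) -> ptime (fun z => enc_seq enc (s2 z)) ->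
  ptime (fun z => enc_seq enc (s1 z ++ s2 z)).
Proof.
by move=> ps1 ps2; apply: eq_ptime (ptime_app ps1 ps2) => z; rewrite tapp_enc.
Qed.

(** * Unary numbers *)

(** Intermediate numbers are unary, so that arithmetic is recursion on lists. They stay polynomial
    in the number of vertices, and binary digits appear only in the output. *)
Definition un n := iter n (Cons Nil) Nil.

Fixpoint tlen t := if t is Cons _ u then (tlen u).+1 else 0.

Lemma tlen_un n : tlen (un n) = n.
Proof. by elim: n => //= n ->. Qed.

Lemma tlen_enc T (enc : T -> tree) s : tlen (enc_seq enc s) = size s.
Proof. by elim: s => //= x s ->. Qed.

Lemma tsize_un n : tsize (un n) = n.*2.+1.
Proof. by elim: n => //= n ->; lia. Qed.

Lemma tfold_un g i n : tfold (fun=> g) i (un n) = iter n g i.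
Proof. by elim: n => //= n ->. Qed.

Lemma ptime_tlen F : ptime F -> ptime (fun z => un (tlen (F z))).
Proof.
move=> pF; apply: (@eq_ptime (fun z => tfold (fun _ x => Cons Nil x) Nil (F z))).
  by move=> z; elim: (F z) => //= a _ u ->.
apply: (ptime_fold (G := fun _ _ => Cons Nil) (D := fun=> 2)) => //; try exact: ptime_cst.
- exact: ptime_cons (ptime_cst _) ptime_acc.
- exact: pbound_cst.
- by move=> z a x _ /=; lia.
Qed.

Lemma ptime_drop F n : ptime F -> ptime (fun z => un (n z)) ->
  ptime (fun z => iter (n z) ttl (F z)).
Proof.
move=> pF pn; apply: eq_ptime (fun z => tfold_un ttl (F z) (n z)) _.
apply: (ptime_fold (G := fun _ _ => ttl) (D := fun=> 0)) => //.
- exact: ptime_tl ptime_acc.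
- exact: pbound_cst.
- by move=> z a [|x y] _ /=; lia.
Qed.

(** As [ttl Nil] is [Nil], removing cells one by one is truncated subtraction. *)
Lemma ptime_subn m n : ptime (fun z => un (m z)) -> ptime (fun z => un (n z)) ->
  ptime (fun z => un (m z - n z)).
Proof.
move=> pm pn; apply: eq_ptime (ptime_drop pm pn) => z.
elim: (n z) => [|k /= ->]; first by rewrite subn0.
by rewrite subnS; case: (m z - k).
Qed.

Lemma tapp_un m n : tapp (un m) (un n) = un (m + n).
Proof. by elim: m => //= m; rewrite /tapp /= => ->. Qed.

Lemma ptime_addn m n : ptime (fun z => un (m z)) -> ptime (fun z => un (n z)) ->
  ptime (fun z => un (m z + n z)).
Proof.
by move=> pm pn; apply: eq_ptime (ptime_app pm pn) => z; rewrite tapp_un.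
Qed.

Lemma ptime_muln m n : ptime (fun z => un (m z)) -> ptime (fun z => un (n z)) ->
  ptime (fun z => un (m z * n z)).
Proof.
move=> pm pn.
apply: (@eq_ptime (fun z => tfold (fun=> tapp (un (n z))) Nil (un (m z)))) => [z|].
  by rewrite tfold_un; elim: (m z) => //= k ->; rewrite mulSn tapp_un.
apply: (ptime_fold (G := fun z _ => tapp (un (n z))) (D := fun z => tsize (un (n z)))) => //.
- exact: ptime_app (ptime_sub pn ptime_ctx) ptime_acc.
- exact: ptime_cst.
- exact: pbound_ptime.
- by move=> z a x _; have := tsize_tapp (un (n z)) x; lia.
Qed.

Lemma ptime_iota n : ptime (fun z => un (n z)) ->
  ptime (fun z => enc_seq un (iota 0 (n z))).
Proof.
move=> pn.
(* The list is built from its end; the length of the part already built determines the next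
   entry. *)
apply: (@eq_ptime (fun z => tfold (fun _ x => Cons (un (n z - (tlen x + 1))) x) Nil (un (n z)))).
  move=> z; rewrite tfold_un.
  suff iterE k : k <= n z -> iter k (fun x => Cons (un (n z - (tlen x + 1))) x) Nil
      = enc_seq un (iota (n z - k) k) by rewrite iterE // subnn.
  elim: k => //= k IHk lt_k; rewrite IHk; last exact: ltnW.
  by rewrite tlen_enc size_iota addn1 -(subnSK lt_k).
apply: (ptime_fold (G := fun z _ x => Cons (un (n z - (tlen x + 1))) x)
  (D := fun z => tsize (un (n z)) + 1)) => //.
- apply: ptime_cons ptime_acc; apply: ptime_subn (ptime_sub pn ptime_ctx) _.
  exact: ptime_addn (ptime_tlen ptime_acc) (ptime_cst (un 1)).
- exact: ptime_cst.
- exact: pbound_add (pbound_ptime pn) (pbound_cst 1).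
- by move=> z a x _ /=; rewrite !tsize_un; lia.
Qed.

Definition tmap f t := tfold (fun a x => Cons (f a) x) Nil t.

Lemma tmap_enc T (enc : T -> tree) f s :
  tmap f (enc_seq enc s) = enc_seq (fun x => f (enc x)) s.
Proof. by rewrite /tmap; elim: s => //= x s ->. Qed.

Lemma ptime_map (F : tree -> tree -> tree) L :
    ptime L -> ptime (fun w => F (thd w) (ttl w)) -> ptime (fun z => tmap (F z) (L z)).
Proof.
move=> pL pF; have [k lek] := pbound_ptime pF.
apply: (ptime_fold (G := fun z a x => Cons (F z a) x)
  (* An element is no larger than the list, so this bounds the size of one image, plus the [Cons]
     that attaches it. *)
  (D := fun z => k * (tsize z + tsize (L z) + 1) ^ k + 1)) => //.
- apply: ptime_cons ptime_acc.
  exact: ptime_sub pF (ptime_cons ptime_ctx ptime_elt).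
- exact: ptime_cst.
- apply: pbound_add (pbound_cst 1); apply: pbound_mul (pbound_cst _) (pbound_exp k _).
  by apply: pbound_add (pbound_cst 1); apply: pbound_add pbound_tsize (pbound_ptime pL).
- move=> z a x le_a /=; have /= := lek (Cons z a).
  suff: k * (tsize z + tsize a).+1 ^ k <=
    k * (tsize z + tsize (L z) + 1) ^ k by lia.
  by rewrite leq_mul // leq_expr //; lia.
Qed.

(** The body runs on the pair of the context and the unary index. In nested families, the outer
    indices are thus reached through [thd]. *)
Lemma ptime_map_iota T (enc : T -> tree) (f : tree -> nat -> T) n :
    ptime (fun z => un (n z)) -> ptime (fun w => enc (f (thd w) (tlen (ttl w)))) ->
  ptime (fun z => enc_seq enc [seq f z i | i <- iota 0 (n z)]).
Proof.
move=> pn pf.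
apply: eq_ptime (ptime_map (F := fun z t => enc (f z (tlen t))) (ptime_iota pn) pf) => z.
by rewrite tmap_enc; elim: (iota _ _) => //= i s ->; rewrite tlen_un.
Qed.

Lemma ptime_flatten_iota T (enc : T -> tree) (f : tree -> nat -> seq T) n :
    ptime (fun z => un (n z)) ->
    ptime (fun w => enc_seq enc (f (thd w) (tlen (ttl w)))) ->
  ptime (fun z => enc_seq enc (flatten [seq f z i | i <- iota 0 (n z)])).
Proof.
move=> pn pf.
apply: (@eq_ptime (fun z => tfold (fun a x => tapp a x) Nil
    (enc_seq (enc_seq enc) [seq f z i | i <- iota 0 (n z)]))).
  by move=> z; elim: (iota _ _) => //= i s ->; rewrite tapp_enc.
have pL := ptime_map_iota pn pf.
apply: (ptime_fold (G := fun=> tapp) (D := fun z => tsize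
    (enc_seq (enc_seq enc) [seq f z i | i <- iota 0 (n z)]))) => //.
- exact: ptime_app ptime_elt ptime_acc.
- exact: ptime_cst.
- exact: pbound_ptime.
- by move=> z a x; have := tsize_tapp a x; lia.
Qed.

(** * Tests *)

Lemma ptime_is_cons F : ptime F -> ptime (fun z => enc_bool (is_cons (F z))).
Proof.
move=> pF; apply: (@eq_ptime (fun z => tfold (fun _ _ => enc_bool true) Nil (F z))).
  by move=> z; case: (F z).
apply: (ptime_fold (G := fun _ _ _ => enc_bool true) (D := fun=> 3)) => //; try exact: ptime_cst.
- exact: pbound_cst.
- by move=> z a x _; rewrite leq_addl.
Qed.

Lemma ptime_andb p q : ptime (fun z => enc_bool (p z)) -> ptime (fun z => enc_bool (q z)) ->
  ptime (fun z => enc_bool (p z && q z)).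
Proof.
move=> pp pq; apply: eq_ptime (ptime_if pp pq (ptime_cst Nil)) => z.
by case: (p z).
Qed.

Lemma ptime_orb p q : ptime (fun z => enc_bool (p z)) -> ptime (fun z => enc_bool (q z)) ->
  ptime (fun z => enc_bool (p z || q z)).
Proof.
move=> pp pq; apply: eq_ptime (ptime_if pp (ptime_cst (enc_bool true)) pq) => z.
by case: (p z).
Qed.

Lemma ptime_negb p : ptime (fun z => enc_bool (p z)) -> ptime (fun z => enc_bool (~~ p z)).
Proof.
move=> pp; apply: eq_ptime (ptime_if pp (ptime_cst Nil) (ptime_cst (enc_bool true))) => z.
by case: (p z).
Qed.

Lemma ptime_eqn m n : ptime (fun z => un (m z)) -> ptime (fun z => un (n z)) ->
  ptime (fun z => enc_bool (m z == n z)).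
Proof.
have unE k : ~~ is_cons (un k) = (k == 0) by case: k.
(* Comparison is the vanishing of a truncated difference, and equality is comparison both ways. *)
have leqP' m' n' : ptime (fun z => un (m' z)) -> ptime (fun z => un (n' z)) ->
    ptime (fun z => enc_bool (m' z <= n' z)).
  move=> pm pn; apply: eq_ptime (ptime_negb (ptime_is_cons (ptime_subn pm pn))) => z.
  by rewrite unE.
move=> pm pn; apply: eq_ptime (ptime_andb (leqP' _ _ pm pn) (leqP' _ _ pn pm)) => z.
by rewrite eqn_leq.
Qed.

Lemma ptime_nth F n : ptime F -> ptime (fun z => un (n z)) ->
  ptime (fun z => thd (iter (n z) ttl (F z))).
Proof. by move=> pF pn; apply: ptime_hd; apply: ptime_drop. Qed.

Lemma nth_enc T (enc : T -> tree) x0 s i : i < size s ->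
  thd (iter i ttl (enc_seq enc s)) = enc (nth x0 s i).
Proof.
move=> lt_i; have ->: iter i ttl (enc_seq enc s) = enc_seq enc (drop i s).
  elim: i s {lt_i} => [|i IHi] [|x s] //; rewrite ?drop0 // iterSr.
  - by elim: i {IHi} => //= i ->.
  - exact: IHi.
by rewrite (drop_nth x0 lt_i).
Qed.

(** * Binary numbers *)

(* Adds the carry [c] to a list of bits, least significant first. *)
Fixpoint taddc (c : bool) (t : tree) :=
  if t is Cons b u then
    if is_cons b then Cons (if c then Nil else b) (taddc c u)
    else Cons (if c then enc_bool true else b) (taddc false u)
  else if c then Cons (enc_bool true) Nil else Nil.

Lemma taddc_false t : taddc false t = t.
Proof. by elim: t => //= b _ u ->; case: is_cons. Qed.

Lemma tsize_taddc c t : tsize (taddc c t) <= tsize t + 4.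
Proof.
elim: t c => [|b _ u IHu] [] //=; try lia; case: b => [|b1 b2] //=;
  rewrite ?taddc_false; try lia; have := IHu true; lia.
Qed.

(** Incrementing is the only binary operation to be programmed, since a unary number is converted by
    counting. *)
Lemma enc_natS n : enc_nat n.+1 = taddc true (enc_nat n).
Proof.
have enc_succ p : enc_seq enc_bool (pos_bits (BinPos.Pos.succ p))
    = taddc true (enc_seq enc_bool (pos_bits p)).
  by elim: p => [p IHp|p _|] //=; rewrite ?IHp ?taddc_false.
rewrite /enc_nat -[in LHS](bin_of_natK n); case: (bin_of_nat n) => // p.
have ->: (nat_of_bin (BinNums.Npos p)).+1 = nat_of_bin (BinNums.Npos (BinPos.Pos.succ p)).
  by rewrite /= nat_of_succ_pos.
by rewrite nat_of_binK enc_succ.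
Qed.

(** As [taddc] hands its carry down the recursion, it is not a right fold in its digits. The state
    of this left fold has the carry as head and the digits produced so far, in reverse order, as
    tail. *)
Definition addc_step a x :=
  let c := thd x in
  if is_cons a then
    if is_cons c then Cons c (Cons Nil (ttl x)) else Cons c (Cons a (ttl x))
  else if is_cons c then Cons Nil (Cons c (ttl x)) else Cons Nil (Cons a (ttl x)).

(** A carry that survives the last digit becomes the new leading digit. *)
Lemma foldl_addc c t u :
  let x := tfoldl addc_step t (Cons (enc_bool c) u) in
  (if is_cons (thd x) then Cons (thd x) (ttl x) else ttl x) = tfoldl Cons (taddc c t) u.
Proof.
move=> x; rewrite {}/x; elim: t c u => [|a _ t IHt] c u; first by case: c.
case: a => [|b1 b2]; case: c.
- exact: (IHt false).
- exact: (IHt false).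
- exact: (IHt true).
- exact: (IHt false).
Qed.

Lemma ptime_taddc F : ptime F -> ptime (fun z => taddc true (F z)).
Proof.
move=> pF; pose x z := tfoldl addc_step (F z) (Cons (enc_bool true) Nil).
apply: (@eq_ptime (fun z =>
    tfoldl Cons (if is_cons (thd (x z)) then Cons (thd (x z)) (ttl (x z)) else ttl (x z)) Nil)).
  move=> z; rewrite foldl_addc tfoldl_rev /=.
  by elim: (taddc true (F z)) => //= b _ l ->.
have px : ptime x.
  apply: (ptime_foldl (G := fun=> addc_step) (D := fun z => tsize (F z) + 3)) => //.
  - have pc : ptime (fun w => thd (ttl (ttl w))) by apply: ptime_hd ptime_acc.
    have pu : ptime (fun w => ttl (ttl (ttl w))) by apply: ptime_tl ptime_acc.
    apply: ptime_if; first exact: ptime_is_cons ptime_elt.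
      apply: ptime_if; first exact: ptime_is_cons.
        exact: ptime_cons pc (ptime_cons (ptime_cst Nil) pu).
      exact: ptime_cons pc (ptime_cons ptime_elt pu).
    apply: ptime_if; first exact: ptime_is_cons.
      exact: ptime_cons (ptime_cst Nil) (ptime_cons pc pu).
    exact: ptime_cons (ptime_cst Nil) (ptime_cons ptime_elt pu).
  - exact: ptime_cst.
  - exact: pbound_add (pbound_ptime pF) (pbound_cst 3).
  - move=> z a x' le_a; apply: (@leq_trans (tsize x' + (tsize a + 3))); last by rewrite leq_add2l leq_add2r.
    by rewrite /addc_step; case: a {le_a} => [|a1 a2]; case: x' => [|[|c1 c2] u] //=; lia.
apply: ptime_rev; apply: ptime_if; first exact: ptime_is_cons (ptime_hd px).
- exact: ptime_cons (ptime_hd px) (ptime_tl px).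
- exact: ptime_tl.
Qed.

(** Each increment lengthens the digits by a constant at most, as [ptime_fold] demands. *)
Lemma ptime_enc_nat n : ptime (fun z => un (n z)) -> ptime (fun z => enc_nat (n z)).
Proof.
move=> pn; apply: (@eq_ptime (fun z => tfold (fun=> taddc true) Nil (un (n z)))).
  by move=> z; rewrite tfold_un; elim: (n z) => //= k ->; rewrite enc_natS.
apply: (ptime_fold (G := fun _ _ => taddc true) (D := fun=> 4)) => //.
- exact: ptime_taddc ptime_acc.
- exact: ptime_cst.
- exact: pbound_cst.
- by move=> z a x _; apply: tsize_taddc.
Qed.

Lemma ptime_enc_cons T (enc : T -> tree) x s :
    ptime (fun z => enc (x z)) -> ptime (fun z => enc_seq enc (s z)) ->
  ptime (fun z => enc_seq enc (x z :: s z)).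
Proof. exact: ptime_cons. Qed.

Lemma ptime_enc_if T (enc : T -> tree) p (x y : tree -> T) :
    ptime (fun z => enc_bool (p z)) ->
    ptime (fun z => enc (x z)) -> ptime (fun z => enc (y z)) ->
  ptime (fun z => enc (if p z then x z else y z)).
Proof.
by move=> pp px py; apply: eq_ptime (ptime_if pp px py) => z; case: (p z).
Qed.

(** * The formula *)

Definition clause := seq (bool * nat).

Definition enc_lit (l : bool * nat) := Cons (enc_bool l.1) (un l.2).

Definition enc_clause : clause -> tree := enc_seq enc_lit.

Lemma ptime_enc_lit b i : ptime (fun z => un (i z)) -> ptime (fun z => enc_lit (b, i z)).
Proof. by move=> pi; apply: ptime_cons pi; apply: ptime_cst. Qed.

(* The variable [var d n 0 k u v] says that, in dimension [k], the interval of
   [u] lies to the left of the interval of [v], and [var d n 1 k u v] that the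
   left end of [u] is at most the left end of [v]. *)
Definition var d n t k u v := ((t * d + k) * n + u) * n + v.

Definition last_var d n := 2 * d * n * n.

Definition clauses_at d n (e : rel nat) u v : seq clause :=
  (if (u == v) || e u v then [seq [:: (false, var d n 0 k u v)] | k <- iota 0 d]
   else [:: [seq (true, var d n 0 k u v) | k <- iota 0 d] ++
            [seq (true, var d n 0 k v u) | k <- iota 0 d]]) ++
  [seq [:: (true, var d n 1 k u v); (true, var d n 1 k v u)] | k <- iota 0 d] ++
  flatten [seq [seq [:: (false, var d n 0 k u v); (false, var d n 1 k v w);
                        (true, var d n 0 k u w)] | w <- iota 0 n] | k <- iota 0 d].

Definition clauses d n (e : rel nat) : seq clause :=
  flatten [seq flatten [seq clauses_at d n e u v | v <- iota 0 n] | u <- iota 0 n].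

(** Adjacency is read directly from the encoded matrix, which makes the clauses a function of the
    input tree. *)
Definition tadj z i j := is_cons (thd (iter j ttl (thd (iter i ttl z)))).

Lemma ptime_var d n t k u v :
    ptime (fun z => un (n z)) -> ptime (fun z => un (k z)) ->
    ptime (fun z => un (u z)) -> ptime (fun z => un (v z)) ->
  ptime (fun z => un (var d (n z) t (k z) (u z) (v z))).
Proof.
move=> pn pk pu pv; apply: ptime_addn pv; apply: ptime_muln (pn).
apply: ptime_addn pu; apply: ptime_muln (pn).
exact: ptime_addn (ptime_cst (un (t * d))) pk.
Qed.

Lemma ptime_last_var d n :
  ptime (fun z => un (n z)) -> ptime (fun z => un (last_var d (n z))).
Proof.
move=> pn; do 2!apply: ptime_muln (pn); exact: (ptime_cst (un (2 * d))).
Qed.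

Ltac ptime_arg :=
  repeat first [exact: ptime_id | exact: ptime_cst | apply: ptime_hd | apply: ptime_tl].

Ltac ptime_num :=
  repeat first [apply: ptime_enc_lit | apply: ptime_var | apply: ptime_tlen; ptime_arg |
    exact: (ptime_cst Nil) | apply: ptime_enc_cons].

(** The proof follows the syntax of [clauses]: every range is a loop over a unary number, which is
    the constant [un d] for the dimensions and the length of the matrix for the vertices. *)
Lemma ptime_clauses d :
  ptime (fun z => enc_seq enc_clause (clauses d (tlen z) (tadj z))).
Proof.
apply: ptime_flatten_iota; first exact: ptime_tlen ptime_id.
apply: ptime_flatten_iota; first by ptime_num.
have pd : ptime (fun=> un d) by apply: ptime_cst.
apply: ptime_cat; [|apply: ptime_cat].
- apply: (ptime_enc_if (enc := enc_seq enc_clause)).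
  + apply: ptime_orb; first by apply: ptime_eqn; ptime_num.
    apply: ptime_is_cons; apply: ptime_nth; last by ptime_num.
    by apply: ptime_nth; [ptime_arg | ptime_num].
  + by apply: (ptime_map_iota pd); apply: ptime_enc_cons; ptime_num.
  + apply: ptime_enc_cons; last exact: ptime_cst.
    by apply: ptime_cat; apply: (ptime_map_iota pd); ptime_num.
- apply: (ptime_map_iota pd); ptime_num.
- apply: (ptime_flatten_iota pd).
  by apply: ptime_map_iota; ptime_num.
Qed.

(** * Boxicity and interval orders *)

Lemma interval_representation (T : finType) (P A : rel T) :
    irreflexive P -> total A -> (forall u v w, P u v -> A v w -> P u w) ->
  exists l h : T -> nat,
    (forall v, l v <= h v) /\ (forall u v, P u v = (h u < l v)).
Proof.
move=> Pirr Atot PA.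
(* The right end of [u] is the largest left end among the vertices not entirely to its right; [u] is
   one of them by irreflexivity. *)
pose l v := #|[set u | P u v]|; pose h u := \max_(w | ~~ P u w) l w.
exists l, h; split=> [v|u v].
  by rewrite /h (bigD1 v) ?Pirr //= leq_maxl.
apply/idP/idP => [Puv|]; last first.
  by apply: contraLR => nPuv; rewrite -leqNgt /h (bigD1 v nPuv) /= leq_maxl.
(* The set counted by [l w] is a proper subset of the one counted by [l v]. Indeed [A v w] would
   give [P u w], so totality gives [A w v], hence the inclusion; and [u] is only in the larger
   set. *)
have lt_l w : ~~ P u w -> l w < l v.
  move=> nPuw; apply: proper_card; apply/properP; split.
    apply/fintype.subsetP => x; rewrite !inE => /PA; apply.
    by have /orP[//|/(PA _ _ _ Puv)] := Atot w v; rewrite (negPf nPuw).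
  by exists u; rewrite inE.
have v_gt0 : 0 < l v by apply: leq_ltn_trans (lt_l u _); rewrite ?Pirr.
(* The strict bound on a maximum becomes a weak bound by the predecessor of [l v]. *)
rewrite /h -(prednK v_gt0) ltnS; apply/bigmax_leqP => w /lt_l.
by case: (l v) v_gt0.
Qed.

Section BoxicityOrders.
Import Order.TTheory GRing.Theory Num.Theory.
Local Open Scope ring_scope.
Local Open Scope classical_set_scope.

Lemma box_nonempty (R : realType) d (l h : 'rV[R]_d) :
  box l h !=set0 <-> forall i, l ord0 i <= h ord0 i.
Proof.
split=> [[x xP] i | le_lh]; first by have /andP[/le_trans] := xP i; apply.
by exists l => i; rewrite lexx le_lh.
Qed.

(** The coordinatewise maximum of the two lower corners is a common point. *)
Lemma box_meet (R : realType) d (l h l' h' : 'rV[R]_d) :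
    (forall i, l ord0 i <= h ord0 i) -> (forall i, l' ord0 i <= h' ord0 i) ->
  box l h `&` box l' h' !=set0 <->
    forall i, (l ord0 i <= h' ord0 i) && (l' ord0 i <= h ord0 i).
Proof.
move=> lh lh'; split=> [[x [xP xP']] i | meet].
  have /andP[lx xh] := xP i; have /andP[lx' xh'] := xP' i.
  by rewrite (le_trans lx xh') (le_trans lx' xh).
exists (\row_i Num.max (l ord0 i) (l' ord0 i)); split=> i; have /andP[le1 le2] := meet i;
  by rewrite mxE le_max ge_max lexx ?orbT ?lh ?lh' ?le1 ?le2.
Qed.

Definition box_orders d (G : sgraph) (P A : 'I_d -> rel 'I_(nb_vertices G)) :=
  [/\ forall k (u v : 'I_(nb_vertices G)), (u == v) || adj u v -> ~~ P k u v,
      forall u v : 'I_(nb_vertices G), ~~ ((u == v) || adj u v) -> [exists k, P k u v || P k v u],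
      forall k u v, A k u v || A k v u &
      forall k u v w, P k u v -> A k v w -> P k u w].

(** From boxes, [P] compares right ends with left ends strictly, and [A] compares left ends.
    Conversely, [interval_representation] gives natural end points in each dimension, which are cast
    to [R]. *)
Lemma has_boxicityP (R : realType) d (G : sgraph) :
  has_boxicity R d G <-> exists P A, @box_orders d G P A.
Proof.
split=> [[B [Bbox adjB]] | [P [A [nonP exP totA PA]]]].
  have /boolp.choice[lh lhP] v : exists lh : 'rV[R]_d * 'rV[R]_d, B v = box lh.1 lh.2.
    by have [[l [h ->]] _] := Bbox v; exists (l, h).
  pose l v i := (lh v).1 ord0 i; pose h v i := (lh v).2 ord0 i.
  have le_lh v i : l v i <= h v i.
    by have [_] := Bbox v; rewrite lhP => /box_nonempty; apply.
  have adjP u v : u != v -> adj u v <-> forall i, (l u i <= h v i) && (l v i <= h u i).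
    by move=> neq_uv; rewrite adjB // !lhP; apply: box_meet; apply: le_lh.
  exists (fun k u v => h u k < l v k), (fun k u v => l u k <= l v k); split.
  - move=> k u v; rewrite -leNgt; have [->|neq_uv /=] := eqVneq u v; first by rewrite le_lh.
    by move=> /(adjP _ _ neq_uv)/(_ k)/andP[].
  - move=> u v; rewrite negb_or => /andP[neq_uv]; apply: contraR => /existsPn sepF.
    apply/(adjP _ _ neq_uv) => k.
    by have := sepF k; rewrite negb_or -!leNgt andbC.
  - by move=> k u v; apply: le_total.
  - by move=> k u v w; apply: lt_le_trans.
have repr k : exists lh : ('I_(nb_vertices G) -> nat) * ('I_(nb_vertices G) -> nat),
    (forall v, (lh.1 v <= lh.2 v)%N) /\ (forall u v, P k u v = (lh.2 u < lh.1 v)%N).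
  have Pirr : irreflexive (P k) by move=> u; apply: negbTE; apply: nonP; rewrite eqxx.
  have [l [h lhP]] := interval_representation Pirr (totA k) (PA k).
  by exists (l, h).
have [lh lhP] := boolp.choice repr.
pose l v : 'rV[R]_d := \row_k ((lh k).1 v)%:R; pose h v : 'rV[R]_d := \row_k ((lh k).2 v)%:R.
have le_lh v i : l v ord0 i <= h v ord0 i.
  by rewrite !mxE ler_nat; case: (lhP i).
exists (fun v => box (l v) (h v)); split=> [v | u v neq_uv].
  by split; [exists (l v), (h v) | apply/box_nonempty].
rewrite box_meet //.
have PE k x y : P k x y = ~~ (l y ord0 k <= h x ord0 k).
  by rewrite !mxE ler_nat -ltnNge; case: (lhP k) => _ ->.
split=> [adj_uv k | meet].
  have := nonP k u v; have := nonP k v u; rewrite !PE !negbK (adj_sym v u) adj_uv !orbT.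
  by move=> -> // ->.
apply: contraT => nadj.
have /existsP[k] : [exists k, P k u v || P k v u].
  by apply: exP; rewrite negb_or neq_uv.
by rewrite !PE -negb_and andbC meet.
Qed.

End BoxicityOrders.

(** * Meaning of the clauses *)

Definition sat (a : nat -> bool) (F : seq clause) := all (has (fun l => a l.2 == l.1)) F.

Lemma all_flatten_iota T (p : pred T) (f : nat -> seq T) n :
  reflect (forall i : 'I_n, all p (f i)) (all p (flatten [seq f i | i <- iota 0 n])).
Proof.
have -> : all p (flatten [seq f i | i <- iota 0 n]) = all (fun i => all p (f i)) (iota 0 n).
  by elim: (iota 0 n) => //= i s IHs; rewrite all_cat IHs.
apply: (iffP allP) => [all_f i|all_f i]; first by apply: all_f; rewrite mem_iota ltn_ord.
by rewrite mem_iota => /andP[_ lt_i]; apply: (all_f (Ordinal lt_i)).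
Qed.

Lemma all_map_iota T (p : pred T) (f : nat -> T) n :
  reflect (forall i : 'I_n, p (f i)) (all p [seq f i | i <- iota 0 n]).
Proof.
rewrite all_map; apply: (iffP allP) => [all_f i|all_f i].
  by apply: all_f; rewrite mem_iota ltn_ord.
by rewrite mem_iota => /andP[_ lt_i]; apply: (all_f (Ordinal lt_i)).
Qed.

Lemma has_map_iota T (p : pred T) (f : nat -> T) n :
  has p [seq f i | i <- iota 0 n] = [exists i : 'I_n, p (f i)].
Proof.
rewrite -[LHS]negbK -all_predC -[RHS]negbK negb_exists; congr (~~ _).
by apply/all_map_iota/forallP.
Qed.

(** The four conditions are those of [box_orders], for the relations read off the assignment. *)
Lemma sat_clausesP d n e a :
  sat a (clauses d n e) <-> 
    let P (k : 'I_d) (u v : 'I_n) := a (var d n 0 k u v) in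
    let A (k : 'I_d) (u v : 'I_n) := a (var d n 1 k u v) in
    [/\ forall k (u v : 'I_n), (u == v) || e u v -> ~~ P k u v,
        forall u v : 'I_n, ~~ ((u == v) || e u v) -> [exists k, P k u v || P k v u],
        forall k u v, A k u v || A k v u &
        forall k u v w, P k u v -> A k v w -> P k u w].
Proof.
pose P (k : 'I_d) (u v : 'I_n) := a (var d n 0 k u v).
pose A (k : 'I_d) (u v : 'I_n) := a (var d n 1 k u v).
have clausesE (u v : 'I_n) : sat a (clauses_at d n e u v) <->
    [/\ (u == v) || e u v -> forall k, ~~ P k u v,
        ~~ ((u == v) || e u v) -> [exists k, P k u v || P k v u],
        forall k, A k u v || A k v u &
        forall k w, P k u v -> A k v w -> P k u w].
  rewrite /sat !all_cat; split.
    case/and3P=> sat1 /all_map_iota sat2 /all_flatten_iota sat3; split.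
    - move=> uv k; move: sat1; rewrite -val_eqE in uv; rewrite uv => /all_map_iota/(_ k) /=.
      by rewrite orbF eqbF_neg.
    - move=> nuv; move: sat1; rewrite -val_eqE in nuv; rewrite (negPf nuv) /= andbT has_cat !has_map_iota.
      by case/orP => /existsP[k /eqP Pk]; apply/existsP; exists k; rewrite /P Pk ?orbT.
    - by move=> k; have := sat2 k; rewrite /= orbF !eqb_id.
    - move=> k w; have /all_map_iota/(_ w) /= := sat3 k.
      by rewrite orbF /P /A !eqbF_neg eqb_id; case: (a _); case: (a _).
  case=> sat1 sat2 sat3 sat4; apply/and3P; split.
  - rewrite -[val u == val v]/(u == v); case: ifP => [uv|/negbT nuv].
      by apply/all_map_iota => k /=; rewrite orbF eqbF_neg sat1.
    rewrite /= andbT has_cat !has_map_iota.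
    have /existsP[k /orP[]] := sat2 nuv; rewrite /P => Pk; apply/orP; [left|right];
      by apply/existsP; exists k; rewrite Pk.
  - by apply/all_map_iota => k /=; rewrite orbF !eqb_id; apply: sat3.
  - apply/all_flatten_iota => k; apply/all_map_iota => w /=.
    by rewrite orbF !eqbF_neg eqb_id; have := sat4 k w; rewrite /P /A; do 2!case: (a _) => //=; apply.
split=> [/all_flatten_iota satF | [sat1 sat2 sat3 sat4]].
  have {}satF (u v : 'I_n) : _ := (clausesE u v).1 (elimT (all_flatten_iota _ _ _) (satF u) v).
  split=> [k u v|u v|k u v|k u v w]; have [sat1 sat2 sat3 sat4] := satF u v.
  - by move=> uv; apply: sat1.
  - exact: sat2.
  - exact: sat3.
  - exact: sat4.
apply/all_flatten_iota => u; apply/all_flatten_iota => v; apply/clausesE.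
by split=> [uv k||k|k w]; [apply: sat1|apply: sat2|apply: sat3|apply: sat4].
Qed.

(** An index is a numeral in mixed radix with digits [k], [u], [v] and leading part [t]; three
    Euclidean divisions recover them. *)
Lemma var_inj d n t t' (k k' : 'I_d) (u u' v v' : 'I_n) :
  var d n t k u v = var d n t' k' u' v' -> [/\ t = t', k = k', u = u' & v = v'].
Proof.
have divE b x y (r r' : 'I_b) : x * b + r = y * b + r' -> x = y /\ r = r'.
  move=> eq_xy; have b_gt0 : 0 < b by case: b r {r' eq_xy} => // -[].
  split; last by apply: val_inj; have := congr1 (modn^~ b) eq_xy; rewrite /= !modnMDl !modn_small.
  by have := congr1 (divn^~ b) eq_xy; rewrite /= !divnMDl // !divn_small // !addn0.
by move=> /divE[/divE[/divE[-> ->] ->] ->].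
Qed.

Lemma tadj_enc_graph (G : sgraph) (u v : 'I_(nb_vertices G)) :
  tadj (enc_graph G) u v = adj u v.
Proof.
rewrite /tadj /enc_graph (nth_enc _ u) ?size_enum_ord // nth_ord_enum.
by rewrite (nth_enc _ v) ?size_enum_ord // nth_ord_enum; case: (adj u v).
Qed.

Lemma sat_boxicity (R : realType) d (G : sgraph) :
  (exists a, sat a (clauses d (nb_vertices G) (tadj (enc_graph G)))) <-> has_boxicity R d G.
Proof.
rewrite has_boxicityP; set n := nb_vertices G.
split=> [[a /sat_clausesP[nonP exP totA PA]] | [P [A [nonP exP totA PA]]]].
  exists (fun k u v => a (var d n 0 k u v)), (fun k u v => a (var d n 1 k u v)).
  split=> //; first by move=> k u v; rewrite -tadj_enc_graph; apply: nonP.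
  by move=> u v; rewrite -tadj_enc_graph; apply: exP.
(* The assignment decodes an index by searching for its digits; by [var_inj] at most one choice
   fits. *)
pose a i := [exists k : 'I_d, exists u : 'I_n, exists v : 'I_n,
  (i == var d n 0 k u v) && P k u v || (i == var d n 1 k u v) && A k u v].
have aP (k : 'I_d) (u v : 'I_n) : a (var d n 0 k u v) = P k u v.
  apply/idP/idP => [/existsP[k' /existsP[u' /existsP[v']]]|Pk].
    by case/orP=> /andP[/eqP/var_inj[// _ -> -> ->]].
  by apply/existsP; exists k; apply/existsP; exists u; apply/existsP; exists v; rewrite eqxx Pk.
have aA (k : 'I_d) (u v : 'I_n) : a (var d n 1 k u v) = A k u v.
  apply/idP/idP => [/existsP[k' /existsP[u' /existsP[v']]]|Ak].
    by case/orP=> /andP[/eqP/var_inj[// _ -> -> ->]].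
  by apply/existsP; exists k; apply/existsP; exists u; apply/existsP; exists v; rewrite eqxx Ak orbT.
exists a; apply/sat_clausesP; split.
- by move=> k u v; rewrite tadj_enc_graph aP; apply: nonP.
- move=> u v; rewrite tadj_enc_graph => /exP/existsP[k uv].
  by apply/existsP; exists k; rewrite !aP.
- by move=> k u v; rewrite !aA.
- by move=> k u v w; rewrite !aP aA; apply: PA.
Qed.

(** * From clauses to CNF formulas and integer linear programs *)

Lemma enc_seq_map T U (enc : U -> tree) (f : T -> U) s :
  enc_seq enc [seq f x | x <- s] = enc_seq (fun x => enc (f x)) s.
Proof. by elim: s => //= x s ->. Qed.

Lemma eq_enc_seq (T : eqType) (enc enc' : T -> tree) s :
  {in s, enc =1 enc'} -> enc_seq enc s = enc_seq enc' s.
Proof.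
elim: s => //= x s IHs eq_enc; rewrite eq_enc ?mem_head // IHs // => y ys.
by apply: eq_enc; rewrite inE ys orbT.
Qed.

Lemma enc_seq_enum_ord n (enc : nat -> tree) :
  enc_seq (fun i : 'I_n => enc i) (enum 'I_n) = enc_seq enc (iota 0 n).
Proof. by rewrite -val_enum_ord enc_seq_map. Qed.

Definition vars_le N (F : seq clause) := all (all (fun l => l.2 <= N)) F.

Definition cnf_of N (F : seq clause) : cnf :=
  @CNF N.+1 [seq [seq (l.1, inord l.2) | l <- c] | c <- F].

(** Assignments are restricted to ['I_N.+1] or extended along [inord], which is faithful on the
    variables that occur. *)
Lemma cnf_ofP N F : vars_le N F ->
  cnf_satisfiable (cnf_of N F) <-> exists a, sat a F.
Proof.
move=> leF; split=> [[a] | [a satF]] /=.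
  rewrite all_map => satF; exists (fun i => a (inord i)).
  by apply: sub_all satF => c /=; rewrite has_map.
exists (fun i => a i); rewrite all_map; apply/allP => c cF /=; rewrite has_map.
have /hasP[l lc al] := allP satF c cF; apply/hasP; exists l => //=.
by rewrite inordK // ltnS; apply: (allP (allP leF c cF)).
Qed.

Lemma enc_cnf_of N F : vars_le N F ->
  enc_cnf (cnf_of N F) = Cons (enc_nat N.+1)
    (tmap (tmap (fun l => Cons (thd l) (enc_nat (tlen (ttl l))))) (enc_seq enc_clause F)).
Proof.
move=> leF; rewrite /enc_cnf /= enc_seq_map tmap_enc; congr Cons.
apply: eq_enc_seq => c cF; rewrite enc_seq_map tmap_enc.
apply: eq_enc_seq => l lc /=; rewrite tlen_un inordK // ltnS.
exact: (allP (allP leF c cF)).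
Qed.

Lemma ptime_cnf N F : ptime (fun z => un (N z)) -> ptime F ->
  ptime (fun z => Cons (enc_nat (N z).+1)
    (tmap (tmap (fun l => Cons (thd l) (enc_nat (tlen (ttl l))))) (F z))).
Proof.
move=> pN pF; apply: ptime_cons.
  apply: ptime_enc_nat; exact: ptime_cons (ptime_cst Nil) pN.
apply: (ptime_map (F := fun _ => tmap (fun l => Cons (thd l) (enc_nat (tlen (ttl l)))))) => //.
apply: (ptime_map (F := fun _ l => Cons (thd l) (enc_nat (tlen (ttl l))))).
  exact: ptime_tl ptime_id.
apply: ptime_cons; first by ptime_arg.
by apply: ptime_enc_nat; apply: ptime_tlen; ptime_arg.
Qed.

Definition negs (c : clause) := [seq l.2 | l <- c & ~~ l.1].

(** The row and right-hand side of [ilp_of] state the usual inequality: [x] summed over the positive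
    literals plus [1 - x] over the negative ones is at least 1. *)
Definition coef (c : clause) j : int :=
  (((false, j) \in c)%:R - ((true, j) \in c)%:R)%R.

Definition ilp_of N (F : seq clause) : ilp :=
  @ILP N.+1 (size F) 0%R
    (\matrix_(i, j) coef (nth [::] F i) j) (\col_i ((size (negs (nth [::] F i)))%:R - 1)%R).

Lemma mem_negs c i : (i \in negs c) = ((false, i) \in c).
Proof.
by elim: c => // -[[] j] c IHc; rewrite [RHS]inE xpair_eqE -IHc.
Qed.

Lemma sum_mem_ord N (s : seq nat) : uniq s -> all (fun i => i <= N) s ->
  \sum_(j < N.+1) (val j \in s) = size s.
Proof.
move=> uniq_s le_s; rewrite -(big_mkord xpredT (fun i => nat_of_bool (i \in s))).
transitivity (count (mem s) (iota 0 N.+1)).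
  rewrite -sum1_count [RHS]big_mkcond /index_iota subn0.
  by apply: eq_bigr => i _; rewrite -[mem s i]/(i \in s); case: (i \in s).
rewrite -size_filter; apply/perm_size/uniq_perm => //; first exact/filter_uniq/iota_uniq.
move=> i; rewrite mem_filter mem_iota add0n /= ltnS andbC.
by apply: andb_idl => /(allP le_s).
Qed.

(** * Clauses as linear inequalities *)

Section Ilp.
Import Order.TTheory GRing.Theory Num.Theory.
Local Open Scope ring_scope.

(** The right-hand side counts occurrences of negative literals, while [coef] only tests membership;
    [uniq] makes the two agree. *)
Definition wf_clause N (c : clause) := all (fun l => l.2 <= N)%N c && uniq (negs c).

(** The constant [size (negs c)] is spread over the negated variables, one unit each, so that the
    inequality can be judged variable by variable. *)
Definition slack (c : clause) (y : int) j : int :=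
  ((false, j) \in c)%:R * (y - 1) - ((true, j) \in c)%:R * y.

Lemma ilp_rowE N (c : clause) (x : 'cV[int]_N.+1) : wf_clause N c ->
  (\sum_(j < N.+1) coef c j * x j ord0 <= (size (negs c))%:R - 1)
    = (\sum_(j < N.+1) slack c (x j ord0) j <= -1).
Proof.
case/andP=> le_c uniq_c.
have le_negs : all (fun i => i <= N)%N (negs c).
  by rewrite all_map all_filter; apply: sub_all le_c => l /= ->; rewrite implybT.
rewrite -(sum_mem_ord uniq_c le_negs) natr_sum -lerBlDl -sumrB.
congr (_ <= _); apply: eq_bigr => j _.
by rewrite mem_negs /coef /slack mulrBl mulrBr mulr1 addrAC.
Qed.

(* Positive integers stand for true and the other ones for false; as the
   slacks of an unsatisfied clause are then all nonnegative, the variables need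
   no bounds. *)
Lemma has_slack N (c : clause) (x : 'cV[int]_N.+1) :
    \sum_(j < N.+1) slack c (x j ord0) j <= -1 ->
  has (fun l => (1 <= x (inord l.2) ord0) == l.1) c.
Proof.
move=> le_sum; apply: contraT => /hasPn falsec; have := le_sum.
rewrite leNgt (lt_le_trans (y := 0)) // sumr_ge0 // => j _.
rewrite /slack; have := falsec (true, val j); have := falsec (false, val j).
rewrite /= inord_val eqbF_neg negbK eqb_id -ltNge.
by case: (_ \in c) => [/(_ isT) x_ge1|_]; case: (_ \in c) => [/(_ isT) x_lt1|_]; lia.
Qed.

(** With values 0 and 1 no slack is positive, and the variable of a satisfied literal contributes
    exactly -1. *)
Lemma slack_has N (c : clause) (a : nat -> bool) : wf_clause N c ->
    has (fun l => a l.2 == l.1) c ->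
  \sum_(j < N.+1) slack c (a j)%:R j <= -1.
Proof.
case/andP=> /allP le_c _ /hasP[[b i] /= lc /eqP ai].
have i_lt : (i < N.+1)%N by have := le_c _ lc.
rewrite (bigD1 (Ordinal i_lt)) //= -[-1]addr0 lerD //.
  rewrite /slack ai; case: b lc {ai} => ->; case: (_ \in c); lia.
rewrite sumr_le0 // => j _; rewrite /slack.
by case: (a j); case: (_ \in c); case: (_ \in c).
Qed.

Lemma ilp_ofP N F : all (wf_clause N) F ->
  ilp_feasible (ilp_of N F) <-> exists a, sat a F.
Proof.
move=> wfF.
have rowE (x : 'cV[int]_N.+1) (i : 'I_(size F)) :
    ((ilp_mat (ilp_of N F) *m x) i ord0 <= ilp_rhs (ilp_of N F) i ord0)
      = (\sum_(j < N.+1) slack (nth [::] F i) (x j ord0) j <= -1).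
  rewrite -ilp_rowE; last by apply: (allP wfF); apply: mem_nth.
  by rewrite !mxE; congr (_ <= _); apply: eq_bigr => j _; rewrite mxE.
split=> [[x xP] | [a satF]].
  exists (fun i => 1 <= x (inord i) ord0); apply/(all_nthP [::]) => i lt_i.
  by apply: has_slack; rewrite -(rowE _ (Ordinal lt_i)).
exists (\col_j (a j)%:R) => i; rewrite rowE.
under eq_bigr do rewrite mxE.
apply: slack_has; [apply: (allP wfF) | apply: (allP satF)]; exact: mem_nth.
Qed.

(** The encoding of the integer [n - 1]; the case [n = 0] is apart because natural subtraction would
    truncate. *)
Definition enc_rhs n : tree := if n is n'.+1 then enc_int n'%:Z else enc_int (-1).

Lemma enc_ilp_of N F :
  enc_ilp (ilp_of N F) = Cons (enc_seq (fun=> enc_int 0) (iota 0 N.+1))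
    (enc_seq (fun c => Cons (enc_seq (fun j => enc_int (coef c j)) (iota 0 N.+1))
       (enc_rhs (size (negs c)))) F).
Proof.
pose row c := Cons (enc_seq (fun j => enc_int (coef c j)) (iota 0 N.+1))
  (enc_rhs (size (negs c))).
rewrite /enc_ilp -[RHS]/(Cons _ (enc_seq row F)); congr Cons.
  rewrite -(enc_seq_enum_ord _ (fun=> enc_int 0)).
  by apply: eq_enc_seq => j _; rewrite mxE.
transitivity (enc_seq (fun i : 'I_(size F) => row (nth [::] F i)) (enum 'I_(size F))); last first.
  rewrite (enc_seq_enum_ord _ (fun i => row (nth [::] F i))).
  by rewrite -[in RHS](mkseq_nth [::] F) enc_seq_map.
apply: eq_enc_seq => i _; congr Cons.
  rewrite -(enc_seq_enum_ord _ (fun j => enc_int (coef (nth [::] F i) j))).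
  by apply: eq_enc_seq => j _; rewrite mxE.
by rewrite mxE; case: (size _) => //= m; congr enc_int; lia.
Qed.

End Ilp.

(** * Computing the integer program on trees *)

Fixpoint tmem b i t :=
  if t is Cons l u then (is_cons (thd l) == b) && (tlen (ttl l) == i) || tmem b i u
  else false.

Lemma tmem_enc b i (c : clause) : tmem b i (enc_clause c) = ((b, i) \in c).
Proof.
elim: c => //= -[b' i'] c ->; rewrite inE xpair_eqE tlen_un /=.
by rewrite (eq_sym b) (eq_sym i); case: b'.
Qed.

Lemma ptime_tmem b i F : ptime (fun z => un (i z)) -> ptime F ->
  ptime (fun z => enc_bool (tmem b (i z) (F z))).
Proof.
move=> pi pF.
pose G z a x := if (is_cons (thd a) == b) && (tlen (ttl a) == i z) then enc_bool true else x.
apply: (@eq_ptime (fun z => tfold (G z) Nil (F z))).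
  by move=> z; elim: (F z) => //= a _ u ->; rewrite /G; case: ifP.
apply: (ptime_fold (G := G) (D := fun=> 3)) => //; [|exact: ptime_cst|exact: pbound_cst|].
  apply: ptime_if; [|exact: ptime_cst|exact: ptime_acc].
  apply: ptime_andb; last first.
    by apply: ptime_eqn; [apply: ptime_tlen; ptime_arg | apply: ptime_sub pi ptime_ctx].
  have pb : ptime (fun w => enc_bool (is_cons (thd (thd (ttl w))))).
    by apply: ptime_is_cons; ptime_arg.
  (* The sign [b] is fixed outside the program, so comparing with it is the identity or a
     negation. *)
  case: b {G}; first by apply: eq_ptime pb => w; rewrite eqb_id.
  by apply: eq_ptime (ptime_negb pb) => w; rewrite eqbF_neg.
by move=> z a x _; rewrite /G; case: ifP => _; rewrite ?leq_addl ?leq_addr.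
Qed.

Definition tnegs t := tfold (fun l x => if is_cons (thd l) then x else Cons Nil x) Nil t.

Lemma tnegs_enc c : tnegs (enc_clause c) = un (size (negs c)).
Proof. by rewrite /tnegs; elim: c => //= -[[] i] c ->. Qed.

Definition trhs t := if is_cons t then Cons Nil (enc_nat (tlen (ttl t))) else enc_int (-1).

Lemma trhs_un n : trhs (un n) = enc_rhs n.
Proof. by case: n => //= n; rewrite /trhs /= tlen_un. Qed.

(** Coefficients are -1, 0 or 1, so a choice among constants replaces integer arithmetic. *)
Definition tcoef j t : tree :=
  if tmem false j t then if tmem true j t then enc_int 0 else enc_int 1
  else if tmem true j t then enc_int (-1) else enc_int 0.

Lemma tcoef_enc j c : tcoef j (enc_clause c) = enc_int (coef c j).
Proof. by rewrite /tcoef !tmem_enc /coef; case: ifP; case: ifP. Qed.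

Lemma ptime_ilp N F : ptime (fun z => un (N z)) -> ptime F ->
  ptime (fun z => Cons (enc_seq (fun=> enc_int 0) (iota 0 (N z).+1))
    (tmap (fun c => Cons (enc_seq (fun j => tcoef j c) (iota 0 (N z).+1)) (trhs (tnegs c)))
       (F z))).
Proof.
move=> pN pF.
have pN1 : ptime (fun z => un (N z).+1) by apply: ptime_cons pN; apply: ptime_cst.
have pcoefs (f : tree -> nat -> tree) n : ptime (fun z => un (n z)) ->
    ptime (fun w => f (thd w) (tlen (ttl w))) -> ptime (fun z => enc_seq (f z) (iota 0 (n z))).
  move=> pn pf; apply: eq_ptime (ptime_map_iota (enc := id) pn pf) => z.
  by rewrite enc_seq_map.
apply: ptime_cons; first by apply: pcoefs => //; apply: ptime_cst.
apply: (ptime_map (F := fun z c =>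
  Cons (enc_seq (fun j => tcoef j c) (iota 0 (N z).+1)) (trhs (tnegs c)))) => //.
apply: ptime_cons.
  apply: (pcoefs (fun w j => tcoef j (ttl w))); first exact: ptime_sub pN1 ptime_ctx.
  have pmem b : ptime (fun w => enc_bool (tmem b (tlen (ttl w)) (ttl (thd w)))).
    by apply: ptime_tmem; [apply: ptime_tlen|]; ptime_arg.
  by apply: ptime_if => //; apply: ptime_if => //; apply: ptime_cst.
have pnegs : ptime (fun w => tnegs (ttl w)).
  apply: (ptime_fold (G := fun _ l x => if is_cons (thd l) then x else Cons Nil x)
    (D := fun=> 2)); [|exact: ptime_cst|ptime_arg|exact: pbound_cst|].
    apply: ptime_if; [|exact: ptime_acc|exact: ptime_cons (ptime_cst Nil) ptime_acc].
    by apply: ptime_is_cons; ptime_arg.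
  by move=> z a x _; case: ifP => _ /=; lia.
apply: ptime_if; [exact: ptime_is_cons | | exact: ptime_cst].
apply: ptime_cons; first exact: ptime_cst.
by apply: ptime_enc_nat; apply: ptime_tlen; apply: ptime_tl.
Qed.

(** * Size of the formula *)

Lemma var_le d n t (k : 'I_d) (u v : 'I_n) : t <= 1 -> var d n t k u v <= last_var d n.
Proof.
move=> t_le; have := ltn_ord k; have := ltn_ord u; have := ltn_ord v.
rewrite /var /last_var => lt_v lt_u lt_k.
have leS x y b r : x < y -> r < b -> x * b + r < y * b.
  by move=> lt_x lt_r; apply: (@leq_trans (x * b + b)); [rewrite ltn_add2l | rewrite -mulSnr leq_mul2r lt_x orbT].
by apply/ltnW/leS => //; apply/leS => //; rewrite mul2n -addnn; nia.
Qed.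

Lemma all_clauses d n e (p : pred clause) :
  (forall u v : 'I_n, all p (clauses_at d n e u v)) -> all p (clauses d n e).
Proof. by move=> pP; do 2![apply/all_flatten_iota => ?]. Qed.

Lemma all_clauses_at d n e (p : pred clause) (u v : 'I_n) :
    (forall k : 'I_d, p [:: (false, var d n 0 k u v)]) ->
    p ([seq (true, var d n 0 k u v) | k <- iota 0 d] ++
       [seq (true, var d n 0 k v u) | k <- iota 0 d]) ->
    (forall k : 'I_d, p [:: (true, var d n 1 k u v); (true, var d n 1 k v u)]) ->
    (forall (k : 'I_d) (w : 'I_n), p [:: (false, var d n 0 k u v);
       (false, var d n 1 k v w); (true, var d n 0 k u w)]) ->
  all p (clauses_at d n e u v).
Proof.
move=> p1 p2 p3 p4; rewrite !all_cat; apply/and3P; split.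
- by case: ifP => _; [apply/all_map_iota | rewrite /= p2].
- exact/all_map_iota.
- by apply/all_flatten_iota => k; apply/all_map_iota.
Qed.

Lemma clauses_wf d n e : all (wf_clause (last_var d n)) (clauses d n e).
Proof.
apply: all_clauses => u v; apply: all_clauses_at => [k||k|k w]; rewrite /wf_clause.
- by rewrite /= var_le.
- rewrite all_cat; apply/andP; split.
    by apply/andP; split; apply/all_map_iota => k /=; apply: var_le.
  by rewrite /negs filter_cat !filter_map /= !filter_pred0.
- by rewrite /= !var_le.
- rewrite /= !var_le // inE !andbT.
  (* The two negated variables differ in type, 0 against 1. *)
  by apply/eqP => /var_inj[].
Qed.

Lemma clauses_vars_le d n e : vars_le (last_var d n) (clauses d n e).
Proof. by apply: sub_all (clauses_wf d n e) => c /andP[]. Qed.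

(** The separation clause has [2 * d] literals, the others at most 3. *)
Lemma clauses_width d n e : all (fun c => size c <= 2 * d + 3) (clauses d n e).
Proof.
apply: all_clauses => u v; apply: all_clauses_at => [k||k|k w] /=; try lia.
by rewrite size_cat !size_map size_iota; lia.
Qed.

Lemma size_flatten_iota T (f : nat -> seq T) m b :
  (forall i, size (f i) <= b) -> size (flatten [seq f i | i <- iota 0 m]) <= m * b.
Proof.
move=> le_f; rewrite -{2}(size_iota 0 m); elim: (iota 0 m) => //= i s IHs.
by rewrite size_cat mulSn leq_add.
Qed.

Lemma size_clauses d n e : size (clauses d n e) <= n * (n * (d + 1 + d + d * n)).
Proof.
apply: size_flatten_iota => u; apply: size_flatten_iota => v.
rewrite !size_cat !size_map size_iota -addnA; apply: leq_add.
  (* Either [d] unit clauses or a single separation clause: [d + 1] covers both. *)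
  by case: ifP => _; rewrite ?size_map ?size_iota /=; lia.
by rewrite leq_add2l; apply: size_flatten_iota => k; rewrite size_map size_iota.
Qed.

Theorem theorem6 (R : realType) (d : nat) (d_gt0 : (1 <= d)%N) :
  (exists f : sgraph -> ilp,
     [/\ ilp_formulation f,
         (exists C : nat, forall G : sgraph,
            (ilp_nvars (f G) <= C * (nb_vertices G ^ d * (nb_vertices G + nb_edges G)))%N),
         (exists C : nat, forall G : sgraph,
            (ilp_ncons (f G) <= C * nb_vertices G ^ (d + 2))%N) &
         (forall G : sgraph, ilp_feasible (f G) <-> has_boxicity R d G)])
  /\
  (exists f : sgraph -> cnf,
     [/\ sat_formulation f,
         (exists C : nat, forall G : sgraph,
            (cnf_nvars (f G) <= C * (nb_vertices G ^ d * (nb_vertices G + nb_edges G)))%N),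
         (exists C : nat, forall G : sgraph,
            (size (cnf_clauses (f G)) <= C * nb_vertices G ^ (d + 2))%N),
         (exists C : nat, forall G : sgraph,
            all (fun c => size c <= C * nb_vertices G ^ d)%N (cnf_clauses (f G))) &
         (forall G : sgraph, cnf_satisfiable (f G) <-> has_boxicity R d G)]).
Proof.
pose N G := last_var d (nb_vertices G).
pose F G := clauses d (nb_vertices G) (tadj (enc_graph G)).
have tlen_graph G : tlen (enc_graph G) = nb_vertices G by rewrite tlen_enc size_enum_ord.
(* There are [2 * d * n * n + 1] variables, at most [2 * d + 1] times [n * n]; one factor [n] is at
   most [n ^ d] because [1 <= d], the other at most [n] plus the number of edges. *)
have leN G : (N G).+1 <= (2 * d + 1) * (nb_vertices G ^ d * (nb_vertices G + nb_edges G)).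
  have := nb_vertices_gt0 G; rewrite /N /last_var; set n := nb_vertices G => n_gt0.
  have le_n : n <= n ^ d by rewrite -{1}(expn1 n) leq_pexp2l.
  by have := leq_mul le_n (leq_addr (nb_edges G) n); nia.
(* As [1 <= n], the sum [2 * d + 1 + d * n] is at most [(3 * d + 1) * n]; the resulting cube of [n]
   is absorbed by [n <= n ^ d]. *)
have leF G : size (F G) <= (3 * d + 1) * nb_vertices G ^ (d + 2).
  apply: leq_trans (size_clauses _ _ _) _.
  have := nb_vertices_gt0 G; set n := nb_vertices G => n_gt0.
  have le_n : n <= n ^ d by rewrite -{1}(expn1 n) leq_pexp2l.
  rewrite expnD mulnCA [n ^ d * _]mulnC; nia.
have pN : ptime (fun z => un (last_var d (tlen z))).
  exact: ptime_last_var (ptime_tlen ptime_id).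
split.
- exists (fun G => ilp_of (N G) (F G)); split.
  + apply: ptime_polytime (ptime_ilp pN (ptime_clauses d)) _ => G.
    rewrite enc_ilp_of tlen_graph tmap_enc; congr Cons.
    apply: eq_enc_seq => c _; rewrite tnegs_enc trhs_un; congr Cons.
    by apply: eq_enc_seq => j _; rewrite tcoef_enc.
  + by exists (2 * d + 1) => G; apply: leN.
  + by exists (3 * d + 1) => G; apply: leF.
  + by move=> G; rewrite ilp_ofP ?clauses_wf //; apply: sat_boxicity.
- exists (fun G => cnf_of (N G) (F G)); split.
  + apply: ptime_polytime (ptime_cnf pN (ptime_clauses d)) _ => G.
    by rewrite enc_cnf_of ?clauses_vars_le // tlen_graph.
  + by exists (2 * d + 1) => G; apply: leN.
  + by exists (3 * d + 1) => G; rewrite size_map; apply: leF.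
  + exists (2 * d + 3) => G; rewrite all_map.
    apply: sub_all (clauses_width _ _ _) => c /= le_c; rewrite size_map.
    by apply: leq_trans le_c _; rewrite leq_pmulr // expn_gt0 nb_vertices_gt0.
  + by move=> G; rewrite cnf_ofP ?clauses_vars_le //; apply: sat_boxicity.
Qed.
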